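(* Let $a,b,c,k$ be positive integers. If each of the graphs $K_{a,b,5k}$, $K_{a,c,5k}$, $K_{a,5k,5k}$, $K_{b,5k,5k}$, and $K_{c,5k,5k}$ can be decomposed into $5$-cycles, then $K_{a+10k,\,b+c+5k,\,15k}$ can also be decomposed into $5$-cycles.
   Context: $K_{r,s,t}$ denotes the complete tripartite graph with parts of sizes $r,s,t$ (no ordering of $r,s,t$ is assumed). A decomposition of a graph into $5$-cycles is a partition of its edge set into edge sets of cycles of length $5$. *)

(* Defs.v *)
From mathcomp Require Import all_boot.

Set Implicit Arguments.
Unset Strict Implicit.
Unset Printing Implicit Defensive.

(* A finite simple graph is a symmetric irreflexive adjacency relation on a
   finType; an edge is the two-element set of its endpoints. *)
Definition edge_set (V : finType) (e : rel V) : {set {set V}} :=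
  [set [set p.1; p.2] | p : V * V & e p.1 p.2].

Definition cycle_edge_set (V : finType) (c : seq V) : {set {set V}} :=
  [set [set x; next c x] | x in c].

(* The bound 2 < l excludes the degenerate closed walks of length at most 2,
   which path.v also counts as cycles. *)
Definition is_cycle_edge_set (V : finType) (e : rel V) (l : nat)
    (C : {set {set V}}) : Prop :=
  2 < l /\
  exists c : l.-tuple V, [/\ uniq c, cycle e c & C = cycle_edge_set c].

Definition cycle_decomposable (V : finType) (e : rel V) (l : nat) : Prop :=
  exists P : {set {set {set V}}},
    partition P (edge_set e) /\
    (forall C : {set {set V}}, C \in P -> is_cycle_edge_set e l C).

Definition tripart_index (r s t : nat) (x : 'I_r + 'I_s + 'I_t) : 'I_3 :=
  match x with
  | inl (inl _) => inord 0
  | inl (inr _) => inord 1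
  | inr _ => inord 2
  end.

Definition complete_tripartite (r s t : nat) : rel ('I_r + 'I_s + 'I_t) :=
  fun x y => tripart_index x != tripart_index y.

Lemma complete_tripartite_sym (r s t : nat) :
  symmetric (@complete_tripartite r s t).
Proof. by move=> x y; rewrite /complete_tripartite eq_sym. Qed.

Lemma complete_tripartite_irr (r s t : nat) :
  irreflexive (@complete_tripartite r s t).
Proof. by move=> x; rewrite /complete_tripartite eqxx. Qed.

(* Main.v *)
Require Import Defs.
From mathcomp Require Import all_boot ssralg finalg zmodp.

Set Implicit Arguments.
Unset Strict Implicit.
Unset Printing Implicit Defensive.

Import GRing.Theory.

(** Decompositions glue along edge-disjoint unions and are carried along
    embeddings, so it suffices to cut the large tripartite graph into small
    tripartite graphs that are known to be decomposable.

    The cut comes from the addition table of a finite abelian group [G].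
    Label the vertices of all three parts by elements of [G].  For each
    [(i, j)], take the vertices labelled [i] in the first part, [j] in the
    second and [- (i + j)] in the third: they span a complete tripartite graph.
    Since any two terms of a triple of sum zero determine the third, every
    edge lies in exactly one of these graphs.  This is
    [cycle_decomposable_latin]; only the sizes of the label classes matter.

    With [G] of order 3, label classes of sizes [a, 5k, 5k] in the first part,
    [b, c, 5k] in the second and [5k, 5k, 5k] in the third produce nine pieces.
    Up to exchanging two parts, each is one of the five given graphs or
    [K_{5k,5k,5k}].  The latter is handled by the same lemma with [G] of order
    [k] and all classes of size 5, which reduces it to [K_{5,5,5}], whose
    decomposition is explicit: fifteen cycles, permuted transitively by the
    rotations of the parts and of the coordinates modulo 5. *)

(** * Gluing and transporting cycle decompositions *)

Lemma edge_setP (V : finType) (e : rel V) (E : {set V}) :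
  reflect (exists x y, e x y /\ E = [set x; y]) (E \in edge_set e).
Proof.
apply: (iffP imsetP) => [[[x y]]|[x [y [exy ->]]]].
  by rewrite inE /= => exy ->; exists x, y.
by exists (x, y); rewrite // inE.
Qed.

(** The blocks of the pieces, taken together, partition the edges: a block is
    never shared between two pieces because a block is nonempty and no edge
    belongs to two pieces.  Symmetry of the pieces is what makes [f i x y] a
    property of the unordered edge [[set x; y]]. *)
Lemma cycle_decomposable_bigcup (V I : finType) (e : rel V) (f : I -> rel V)
    (l : nat) :
  (forall i, symmetric (f i)) ->
  (forall x y, e x y <-> exists i, f i x y) ->
  (forall i j x y, f i x y -> f j x y -> i = j) ->
  (forall i, cycle_decomposable (f i) l) -> cycle_decomposable e l.
Proof.
move=> symf eE injf /fin_all_exists[P /all_and2[partP cycP]].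
have disj i j E : E \in edge_set (f i) -> E \in edge_set (f j) -> i = j.
  move=> /edge_setP[x [y [fxy ->]]] /edge_setP[x' [y' [fxy' eq_xy]]].
  have /set2P x'E : x' \in [set x; y] by rewrite eq_xy set21.
  have /set2P y'E : y' \in [set x; y] by rewrite eq_xy set22.
  have /set2P xE : x \in [set x'; y'] by rewrite -eq_xy set21.
  have /set2P yE : y \in [set x'; y'] by rewrite -eq_xy set22.
  have {}fxy' : f j x y.
    by case: xE yE x'E y'E fxy' => [] ? [] ? [] ? [] ?; subst; rewrite // symf.
  exact: injf fxy fxy'.
exists (\bigcup_i P i); split.
  apply/and3P; split.
  - rewrite eqEsubset; apply/andP; split; apply/subsetP => E.
      case/bigcupP=> C /bigcupP[i _ CPi] EC; apply/edge_setP.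
      have /edge_setP[x [y [fxy ->]]] : E \in edge_set (f i).
        by rewrite -(cover_partition (partP i)); apply/bigcupP; exists C.
      by exists x, y; split=> //; apply/eE; exists i.
    case/edge_setP=> x [y [/eE[i fxy] EE]].
    have : E \in edge_set (f i) by apply/edge_setP; exists x, y.
    rewrite -(cover_partition (partP i)) => /bigcupP[C CPi EC].
    by apply/bigcupP; exists C => //; apply/bigcupP; exists i.
  - apply/trivIsetP => C D /bigcupP[i _ CPi] /bigcupP[j _ DPj] neqCD.
    case: (eqVneq i j) => [eq_ij|neq_ij].
      move: DPj; rewrite -eq_ij => DPi.
      exact: (trivIsetP (partition_trivIset (partP i))).
    rewrite -setI_eq0; apply/eqP/setP => E; rewrite !inE.
    apply/andP => -[EC ED].
    case/eqP: neq_ij; apply: (disj i j E).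
      by rewrite -(cover_partition (partP i)); apply/bigcupP; exists C.
    by rewrite -(cover_partition (partP j)); apply/bigcupP; exists D.
  - apply/bigcupP => -[i _]; by case/and3P: (partP i) => _ _ /negP.
move=> C /bigcupP[i _ /cycP[l2 [c [uc cc CE]]]]; split=> //.
exists c; split=> //; apply: sub_cycle cc => x y fxy; apply/eE; by exists i.
Qed.

(** The last hypothesis on [f] allows isolated vertices outside its image, so
    that a graph spanned by some of the vertices can be regarded as a relation
    on all of them, as gluing requires. *)
Lemma cycle_decomposable_emb (V W : finType) (e : rel V) (e' : rel W)
    (f : V -> W) (l : nat) :
  injective f -> {mono f : x y / e x y >-> e' x y} ->
  (forall x y, e' x y -> x \in codom f /\ y \in codom f) ->
  cycle_decomposable e l -> cycle_decomposable e' l.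
Proof.
move=> injf fE codf [P [partP cycP]].
have injF : injective (fun E : {set V} => f @: E) by exact: imset_inj.
have edgeE : edge_set e' = [set f @: (E : {set V}) | E in edge_set e].
  apply/setP => E; apply/edge_setP/imsetP => [[x' [y' [exy ->]]]|[D]].
    have [/codomP[x xE] /codomP[y yE]] := codf _ _ exy; subst.
    exists [set x; y]; last by rewrite imsetU1 imset_set1.
    by apply/edge_setP; exists x, y; rewrite -fE.
  case/edge_setP=> x [y [exy ->]] ->; exists (f x), (f y).
  by rewrite fE imsetU1 imset_set1.
exists [set [set f @: (E : {set V}) | E in C] | C : {set {set V}} in P]; split.
  by rewrite edgeE imset_partition //; exact: in2W.
move=> _ /imsetP[C /cycP[l2 [c [uc cc ->]]] ->]; split=> //.
exists [tuple of map f c]; split.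
- by rewrite /= map_inj_uniq.
- by rewrite /= cycle_map; apply: sub_cycle cc => x y /=; rewrite fE.
apply/setP => E; apply/imsetP/imsetP => /=.
  case=> _ /imsetP[x xc ->] ->; exists (f x); first exact: map_f.
  by rewrite next_map // imsetU1 imset_set1.
case=> _ /mapP[x xc ->] ->; exists [set x; next c x]; first exact: imset_f.
by rewrite next_map // imsetU1 imset_set1.
Qed.

Definition cycle_rel (V : eqType) (c : seq V) : rel V :=
  fun x y => (x \in c) && (y == next c x) || (y \in c) && (x == next c y).

Lemma cycle_decomposable_cycle (V : finType) (c : seq V) :
  2 < size c -> uniq c -> cycle_decomposable (cycle_rel c) (size c).
Proof.
move=> c_gt2 uc.
have edgeE : edge_set (cycle_rel c) = cycle_edge_set c.
  apply/setP => E; apply/edge_setP/imsetP => [[x [y [+ ->]]]|[x xc ->]].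
    case/orP=> /andP[xc /eqP->]; first by exists x.
    by exists y; rewrite // setUC.
  by exists x, (next c x); rewrite /cycle_rel xc eqxx.
exists [set cycle_edge_set c]; split.
  rewrite edgeE; apply/and3P; split.
  - by rewrite /cover big_set1.
  - by apply/trivIsetP => C D /set1P-> /set1P->; rewrite eqxx.
  - case: c c_gt2 {uc edgeE} => // x c _; apply/set1P => edge0.
    have : [set x; next (x :: c) x] \in cycle_edge_set (x :: c).
      by apply/imsetP; exists x; rewrite ?mem_head.
    by rewrite -edge0 in_set0.
move=> _ /set1P->; split=> //; exists (in_tuple c); split=> //=.
apply: (sub_in_cycle (P := mem c)) (cycle_next uc); last exact/allP.
by move=> x y xc yc /= /eqP <-; rewrite /cycle_rel xc eqxx.
Qed.

(** * Complete tripartite graphs *)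

Definition part (r s t : nat) (x : 'I_r + 'I_s + 'I_t) : nat :=
  match x with inl (inl _) => 0 | inl (inr _) => 1 | inr _ => 2 end.

Lemma complete_tripartiteE (r s t : nat) (x y : 'I_r + 'I_s + 'I_t) :
  complete_tripartite x y = (part x != part y).
Proof.
rewrite /complete_tripartite -val_eqE.
have val_part z : val (tripart_index z) = part z.
  by case: z => [[]|] u /=; rewrite inordK.
by rewrite !val_part.
Qed.

Definition in_parts (r s t : nat)
    (A : {set 'I_r}) (B : {set 'I_s}) (C : {set 'I_t}) (x : 'I_r + 'I_s + 'I_t) :=
  match x with
  | inl (inl u) => u \in A
  | inl (inr u) => u \in B
  | inr u => u \in C
  end.

Lemma cycle_decomposable_in_parts (r s t : nat)
    (A : {set 'I_r}) (B : {set 'I_s}) (C : {set 'I_t}) (l : nat) :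
  cycle_decomposable (@complete_tripartite #|A| #|B| #|C|) l ->
  cycle_decomposable (fun x y : 'I_r + 'I_s + 'I_t =>
    [&& in_parts A B C x, in_parts A B C y & part x != part y]) l.
Proof.
pose f (x : 'I_#|A| + 'I_#|B| + 'I_#|C|) : 'I_r + 'I_s + 'I_t :=
  match x with
  | inl (inl u) => inl (inl (enum_val u))
  | inl (inr u) => inl (inr (enum_val u))
  | inr u => inr (enum_val u)
  end.
have f_in x : in_parts A B C (f x) by case: x => [[]|] u; exact: enum_valP.
have f_codom x : in_parts A B C x -> x \in codom f.
  case: x => [[]|] u /= uS; apply/codomP.
  - by exists (inl (inl (enum_rank_in uS u))); rewrite /= enum_rankK_in.
  - by exists (inl (inr (enum_rank_in uS u))); rewrite /= enum_rankK_in.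
  - by exists (inr (enum_rank_in uS u)); rewrite /= enum_rankK_in.
apply: (@cycle_decomposable_emb _ _ _ _ f).
- by move=> [[]|] u [[]|] v //= [] /enum_val_inj->.
- move=> x y; rewrite !f_in complete_tripartiteE.
  by case: x y => [[]|] u [[]|] v.
- by move=> x y /and3P[/f_codom-> /f_codom->].
Qed.

(** * Cutting along the addition table of a group *)

Lemma card_tnth_eq (T : eqType) (X : seq T) (i : T) :
  #|[set u | tnth (in_tuple X) u == i]| = count_mem i X.
Proof.
rewrite cardsE cardE size_filter -(count_map _ (pred1 i)).
by rewrite -enumT map_tnth_enum.
Qed.

(** The lists [X], [Y], [Z] label the vertices of the three parts.  The edge
    between two vertices with labels [g] and [h] lies in the piece indexed by
    the unique triple of sum zero having [g] and [h] at the two positions of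
    the parts concerned. *)
Lemma cycle_decomposable_latin (G : finZmodType) (X Y Z : seq G) (l : nat) :
  (forall i j : G, cycle_decomposable
     (@complete_tripartite (count_mem i X) (count_mem j Y)
        (count_mem (- (i + j))%R Z)) l) ->
  cycle_decomposable (@complete_tripartite (size X) (size Y) (size Z)) l.
Proof.
move=> dec.
pose cls (S : seq G) i := [set u | tnth (in_tuple S) u == i].
pose inp (p : G * G) :=
  in_parts (cls X p.1) (cls Y p.2) (cls Z (- (p.1 + p.2))%R).
apply: (@cycle_decomposable_bigcup _ (G * G)%type _
  (fun p x y => [&& inp p x, inp p y & part x != part y])).
- by move=> p x y; rewrite andbCA eq_sym.
- move=> x y; rewrite complete_tripartiteE.
  split=> [neq_xy|[p /and3P[]//]].
  have third (g h : G) : (- (g - (g + h)) = h)%R.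
    by rewrite opprB addrAC subrr add0r.
  have third' (g h : G) : (- (- (h + g) + h) = g)%R.
    by rewrite [X in (- X)%R]addrC third.
  pose lab S := tnth (in_tuple S : (size S).-tuple G).
  suff [p [xp yp]] : exists p, inp p x /\ inp p y by exists p; rewrite xp yp.
  case: x y neq_xy => [[]|] u [[]|] v //= _.
  - by exists (lab X u, lab Y v); rewrite !inE.
  - by exists (lab X u, - (lab X u + lab Z v))%R; rewrite !inE /= third !eqxx.
  - by exists (lab X v, lab Y u); rewrite !inE.
  - by exists (- (lab Y u + lab Z v), lab Y u)%R; rewrite !inE /= third' !eqxx.
  - by exists (lab X v, - (lab X v + lab Z u))%R; rewrite !inE /= third !eqxx.
  - by exists (- (lab Y v + lab Z u), lab Y v)%R; rewrite !inE /= third' !eqxx.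
- move=> [i j] [i' j'] x y /and3P[] + + neq_xy /and3P[+ + _].
  case: x y neq_xy => [[]|] u [[]|] v //= _; rewrite !inE /=.
  - by move=> /eqP<- /eqP<- /eqP<- /eqP<-.
  - by move=> /eqP<- /eqP-> /eqP<- /eqP/oppr_inj/addrI->.
  - by move=> /eqP<- /eqP<- /eqP<- /eqP<-.
  - by move=> /eqP<- /eqP-> /eqP<- /eqP/oppr_inj/addIr->.
  - move=> /eqP-> /eqP<- /eqP eq_ij /eqP iE; move: eq_ij.
    by rewrite -iE => /oppr_inj/addrI->.
  - move=> /eqP-> /eqP<- /eqP eq_ij /eqP jE; move: eq_ij.
    by rewrite -jE => /oppr_inj/addIr->.
move=> p; apply: cycle_decomposable_in_parts; rewrite !card_tnth_eq; exact: dec.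
Qed.

Lemma complete_tripartite_swap (r s t l : nat) :
  cycle_decomposable (@complete_tripartite r s t) l ->
  cycle_decomposable (@complete_tripartite s r t) l.
Proof.
pose f r s (x : 'I_r + 'I_s + 'I_t) : 'I_s + 'I_r + 'I_t :=
  match x with
  | inl (inl u) => inl (inr u)
  | inl (inr u) => inl (inl u)
  | inr u => inr u
  end.
have fK r' s' : cancel (@f r' s') (@f s' r') by case=> [[]|].
apply: (@cycle_decomposable_emb _ _ _ _ (@f r s)).
- exact: can_inj (fK _ _).
- by move=> [[]|] u [[]|] v; rewrite !complete_tripartiteE.
- by move=> x y _; rewrite -(fK _ _ x) -(fK _ _ y) !codom_f.
Qed.

(** * The graphs with three equal parts of size a multiple of 5 *)

(** Both coordinates are read cyclically, the part [m] modulo 3 and the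
    position [u] in it modulo 5, so that the rotations act by addition. *)
Definition vertex555 (m u : nat) : 'I_5 + 'I_5 + 'I_5 :=
  match m %% 3 with
  | 0 => inl (inl (inZp u)) | 1 => inl (inr (inZp u)) | _ => inr (inZp u)
  end.

(** The vertices of [K_{5,5,5}] as an explicit list, on which a quantifier over
    the vertices becomes a computation. *)
Definition vertices555 := [seq vertex555 m u | m <- iota 0 3, u <- iota 0 5].

Lemma mem_vertices555 x : x \in vertices555.
Proof.
apply/allpairsP; case: x => [[]|] u;
  [exists (0, u : nat)|exists (1, u : nat)|exists (2, u : nat)];
  by split; rewrite ?mem_iota //= ?ltn_ord // /vertex555 /= valZpK.
Qed.

(** The rotations of the part and of the coordinate act on the edges of
    [K_{5,5,5}] with five orbits, told apart by the difference [d] modulo 5 from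
    the endpoint in part [m] to the endpoint in part [m + 1].  Up to rotation,
    a 5-cycle in a tripartite graph crosses between parts [m] and [m + 1] three
    times and between the other pairs of parts once each; closing up then forces
    the middle one of the three crossings to have [d = 0] if the five
    differences are distinct.  The cycle below realises [d = 1, 0, 2, 3, 4] in
    this order, so its fifteen rotations, indexed by the vertex [v = (m, u)],
    meet each edge once. *)
Definition cycle555 (v : 'I_5 + 'I_5 + 'I_5) :=
  let u : nat :=
    match v with inl (inl u) => u | inl (inr u) => u | inr u => u end in
  let m := part v in
  [:: vertex555 m (u + 4); vertex555 m.+1 u; vertex555 m u;
      vertex555 m.+1 (u + 2); vertex555 m.+2 u].

Lemma cycle555_partition x y :
  size [seq v <- vertices555 | cycle_rel (cycle555 v) x y] = (part x != part y).
Proof.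
have/allP/(_ x (mem_vertices555 x))/allP/(_ y (mem_vertices555 y))/eqP// :
  all (fun x => all (fun y =>
    size [seq v <- vertices555 | cycle_rel (cycle555 v) x y]
      == (part x != part y)) vertices555) vertices555.
by vm_compute.
Qed.

Lemma complete_tripartite_555 :
  cycle_decomposable (@complete_tripartite 5 5 5) 5.
Proof.
apply: (@cycle_decomposable_bigcup _ _ _ (fun v => cycle_rel (cycle555 v))).
- by move=> v x y; rewrite /cycle_rel orbC.
- move=> x y; rewrite complete_tripartiteE.
  have := cycle555_partition x y; rewrite size_filter => count_v.
  have <- : has (fun v => cycle_rel (cycle555 v) x y) vertices555
      = (part x != part y) by rewrite has_count count_v; case: (_ != _).
  split=> [/hasP[v _ vxy]|[v vxy]]; first by exists v.
  by apply/hasP; exists v; rewrite ?mem_vertices555.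
- move=> v w x y vxy wxy; have := cycle555_partition x y.
  have : v \in [seq v <- vertices555 | cycle_rel (cycle555 v) x y].
    by rewrite mem_filter vxy mem_vertices555.
  have : w \in [seq v <- vertices555 | cycle_rel (cycle555 v) x y].
    by rewrite mem_filter wxy mem_vertices555.
  case: [seq v <- _ | _] => [//|v0 [|v1 s]]; last by case: (_ != _).
  by rewrite !inE => /eqP-> /eqP->.
- move=> v; apply: (cycle_decomposable_cycle (c := cycle555 v)) => //.
  have/allP/(_ v (mem_vertices555 v))// :
    all (fun v => uniq (cycle555 v)) vertices555.
  by vm_compute.
Qed.

(** Repeating the list of all labels five times gives label classes of size 5
    in each part, hence only pieces [K_{5,5,5}]. *)
Lemma complete_tripartite_5k (k : nat) : 0 < k ->
  cycle_decomposable (@complete_tripartite (5 * k) (5 * k) (5 * k)) 5.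
Proof.
case: k => // k _.
pose X := flatten (nseq 5 (enum 'I_k.+1)).
have sizeX : size X = 5 * k.+1.
  by rewrite size_flatten /shape map_nseq sumn_nseq -cardE card_ord mulnC.
have countX i : count_mem i X = 5.
  rewrite count_flatten map_nseq sumn_nseq count_uniq_mem ?enum_uniq //.
  by rewrite mem_enum.
rewrite -sizeX; apply: cycle_decomposable_latin => i j; rewrite !countX.
exact: complete_tripartite_555.
Qed.

(** * The main decomposition *)

Theorem theorem4p7 (a b c k : nat)
    (ha : 0 < a) (hb : 0 < b) (hc : 0 < c) (hk : 0 < k)
    (hab : cycle_decomposable (@complete_tripartite a b (5 * k)) 5)
    (hac : cycle_decomposable (@complete_tripartite a c (5 * k)) 5)
    (haa : cycle_decomposable (@complete_tripartite a (5 * k) (5 * k)) 5)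
    (hbb : cycle_decomposable (@complete_tripartite b (5 * k) (5 * k)) 5)
    (hcc : cycle_decomposable (@complete_tripartite c (5 * k) (5 * k)) 5) :
  cycle_decomposable
    (@complete_tripartite (a + 10 * k) (b + c + 5 * k) (15 * k)) 5.
Proof.
pose blocks (p q r : nat) : seq 'I_3 :=
  nseq p (inZp 0) ++ nseq q (inZp 1) ++ nseq r (inZp 2).
have size_blocks p q r : size (blocks p q r) = p + q + r.
  by rewrite !size_cat !size_nseq addnA.
have count_blocks p q r (i : 'I_3) :
    count_mem i (blocks p q r) = nth 0 [:: p; q; r] i.
  rewrite !count_cat !count_nseq.
  by case: i => [[|[|[|]]] ?]; rewrite //= !(mul0n, mul1n, addn0).
have -> : a + 10 * k = size (blocks a (5 * k) (5 * k)).
  by rewrite size_blocks -addnA -mulnDl.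
have -> : b + c + 5 * k = size (blocks b c (5 * k)) by rewrite size_blocks.
have -> : 15 * k = size (blocks (5 * k) (5 * k) (5 * k)).
  by rewrite size_blocks -!mulnDl.
apply: cycle_decomposable_latin => i j; rewrite !count_blocks.
have -> (m : 'I_3) : nth 0 [:: 5 * k; 5 * k; 5 * k] m = 5 * k.
  by case: m => [[|[|[|]]] ?].
have h5 := complete_tripartite_5k hk.
(* For [i] nonzero the first class has size [5k]; the hypotheses on [b] and [c]
   have the class of size [5k] second, hence the swap. *)
case: i => [[|[|[|//]]] ?]; case: j => [[|[|[|//]]] ?] //=;
  exact: complete_tripartite_swap.
Qed.
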